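(* The assignments $E:\mathbf{Barc}\to\mathbf{Mch}^{\mathbf R}$ and $F:\mathbf{Mch}^{\mathbf R}\to\mathbf{Barc}$ described in the context are functors, and they are inverse to each other up to natural isomorphism. In particular, $E$ is an equivalence of categories.
   Context: $\mathbf R$ is the poset category of real numbers. A matching $\sigma:S\to T$ between sets is a partial injective function, viewed as a relation $\sigma\subseteq S\times T$. $\mathbf{Mch}$ is the category with sets as objects and matchings as morphisms, composed as relations: $\tau\circ\sigma=\{(s,u)\mid (s,t)\in\sigma,\ (t,u)\in\tau\text{ for some }t\}$. $\mathbf{Mch}^{\mathbf R}$ is the category of functors $\mathbf R\to\mathbf{Mch}$ and natural transformations; for a functor $D$ we write $D_t$ for its value at $t$ and $D_{s,t}:D_s\to D_t$ for its internal morphisms ($s\le t$). An interval is a non-empty set $I\subseteq\mathbb R$ such that $a,c\in I$ and $a<b<c$ imply $b\in I$. A barcode is a multiset representation of intervals: a subset $\mathcal C\subseteq S\times X$ where $S$ is a set of intervals and $X$ is any set (of indices). An element $(I,x)$ of a barcode is usually written simply $I$, suppressing the index (distinct elements with the same underlying interval are kept distinct). For intervals $I,J$: $I$ bounds $J$ above if for all $s\in J$ there is $t\in I$ with $s\le t$; $J$ bounds $I$ below if for all $t\in I$ there is $s\in J$ with $s\le t$. $I$ overlaps $J$ above if $I\cap J\neq\emptyset$, $I$ bounds $J$ above, and $J$ bounds $I$ below. An overlap matching $\sigma:\mathcal C\to\mathcal D$ of barcodes is a matching such that $\sigma(I)=J$ implies that $I$ overlaps $J$ above. $\mathbf{Barc}$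 is the category of barcodes and overlap matchings with composition $\tau\bullet\sigma=\{(I,K)\in\tau\circ\sigma\mid I\text{ overlaps }K\text{ above}\}$. Definition of $E$: for a barcode $\mathcal D$, $E(\mathcal D)_t=\{I\in\mathcal D\mid t\in I\}$ and, for $s\le t$, $E(\mathcal D)_{s,t}=\{(I,I)\mid I\in\mathcal D,\ s,t\in I\}$. For an overlap matching $\sigma:\mathcal C\to\mathcal D$, $E(\sigma)_t=\{(I,J)\in\sigma\mid t\in I\cap J\}$. Definition of $F$: for $D:\mathbf R\to\mathbf{Mch}$, let $\mathcal F(D)=\left(\bigcup_{t\in\mathbb R}\{t\}\times D_t\right)/\sim$, where $(t,x)\sim(u,y)$ if and only if $(x,y)\in D_{t,u}$ or $(y,x)\in D_{u,t}$. For an equivalence class $Q$, $\operatorname{supp}(Q)=\{t\mid (t,x)\in Q\}$, which is an interval. Then $F(D)=\{(\operatorname{supp}(Q),Q)\mid Q\in\mathcal F(D)\}$, a barcode in which the index of the interval $\operatorname{supp}(Q)$ is $Q$. For a natural transformation $\eta:C\to D$, $F(\eta)$ is the set of pairs $((\operatorname{supp}(Q),Q),(\operatorname{supp}(R),R))$ with $Q\in\mathcal F(C)$, $R\in\mathcal F(D)$ such that there exist $t\in\mathbb R$ and $(x,y)\in\eta_t$ with $(t,x)\in Q$ and $(t,y)\in R$. *)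

(* Defs.v *)
From mathcomp Require Import all_boot all_order all_algebra.
From mathcomp Require Import all_classical reals normedtype.

Set Implicit Arguments.
Unset Strict Implicit.
Unset Printing Implicit Defensive.

Import Order.TTheory.
Local Open Scope classical_set_scope.
Local Open Scope ring_scope.

(** * Categories *)

Record category := Category {
  ob :> Type;
  Hom : ob -> ob -> Type;
  idc : forall x, Hom x x;
  compc : forall x y z, Hom y z -> Hom x y -> Hom x z;
  compc_idl : forall x y (f : Hom x y), compc (idc y) f = f;
  compc_idr : forall x y (f : Hom x y), compc f (idc x) = f;
  compcA : forall x y z w (h : Hom z w) (g : Hom y z) (f : Hom x y),
    compc h (compc g f) = compc (compc h g) f }.

Arguments Hom {c} x y.
Arguments idc {c} x.
Arguments compc {c x y z} g f.

Record is_functor (C D : category) (F0 : C -> D)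
    (F1 : forall x y : C, Hom x y -> Hom (F0 x) (F0 y)) : Prop := IsFunctor {
  functor_id : forall x, F1 x x (idc x) = idc (F0 x);
  functor_comp : forall x y z (g : Hom y z) (f : Hom x y),
    F1 x z (compc g f) = compc (F1 y z g) (F1 x y f) }.

Record functor (C D : category) := Functor {
  fob :> C -> D;
  fmor : forall x y : C, Hom x y -> Hom (fob x) (fob y);
  functorP : is_functor fmor }.

Arguments fmor {C D} F {x y} f : rename.

Record nat_trans (C D : category) (F G : functor C D) := NatTrans {
  cmpt :> forall x : C, Hom (F x) (G x);
  naturality : forall (x y : C) (f : Hom x y),
    compc (cmpt y) (fmor F f) = compc (fmor G f) (cmpt x) }.

Arguments cmpt {C D F G} n x.

Definition is_iso (C : category) (x y : C) (f : Hom x y) : Prop :=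
  exists2 g : Hom y x, compc g f = idc x & compc f g = idc y.

Definition nat_isomorphic (C D : category) (F G : functor C D) : Prop :=
  exists eta : nat_trans F G, forall x, is_iso (eta x).

Lemma id_is_functor (C : category) :
  is_functor (fun (x y : C) (f : Hom x y) => f).
Proof. by []. Qed.

Definition functor_1 (C : category) : functor C C :=
  Functor (id_is_functor C).

Lemma comp_is_functor (A B C : category) (G : functor B C) (F : functor A B) :
  is_functor (fun x y (f : Hom x y) => fmor G (fmor F f)).
Proof.
split=> [x|x y z g f].
  by rewrite (functor_id (functorP F)) (functor_id (functorP G)).
by rewrite (functor_comp (functorP F)) (functor_comp (functorP G)).
Qed.

Definition functor_o (A B C : category) (G : functor B C) (F : functor A B) :
  functor A C := Functor (comp_is_functor G F).

Definition is_equivalence (C D : category) (F : functor C D) : Prop :=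
  exists G : functor D C,
    nat_isomorphic (functor_o G F) (functor_1 C) /\
    nat_isomorphic (functor_o F G) (functor_1 D).

Section FunctorCategory.
Variables C D : category.

Lemma nat_trans_ext (F G : functor C D) (a b : nat_trans F G) :
  (forall x, a x = b x) -> a = b.
Proof.
case: a b => [a an] [b bn] /= ab.
have {}ab : a = b by apply: functional_extensionality_dep.
by rewrite ab in an *; rewrite (Prop_irrelevance an bn).
Qed.

Lemma nat_id_natural (F : functor C D) (x y : C) (f : Hom x y) :
  compc (idc (F y)) (fmor F f) = compc (fmor F f) (idc (F x)).
Proof. by rewrite compc_idl compc_idr. Qed.

Definition nat_id (F : functor C D) : nat_trans F F :=
  NatTrans (@nat_id_natural F).

Lemma nat_comp_natural (F G H : functor C D) (b : nat_trans G H)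
    (a : nat_trans F G) (x y : C) (f : Hom x y) :
  compc (compc (b y) (a y)) (fmor F f) = compc (fmor H f) (compc (b x) (a x)).
Proof. by rewrite -compcA naturality compcA naturality compcA. Qed.

Definition nat_comp (F G H : functor C D) (b : nat_trans G H)
    (a : nat_trans F G) : nat_trans F H :=
  NatTrans (nat_comp_natural b a).

Definition functor_cat : category.
Proof.
refine (@Category (functor C D) (@nat_trans C D) nat_id nat_comp _ _ _).
- by move=> F G a; apply: nat_trans_ext => x; apply: compc_idl.
- by move=> F G a; apply: nat_trans_ext => x; apply: compc_idr.
- by move=> F G H K c b a; apply: nat_trans_ext => x; apply: compcA.
Defined.

End FunctorCategory.

Definition poset_cat d (T : porderType d) : category :=
  @Category T (fun x y => (x <= y)%O) (@le_refl d T)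
    (fun x y z yz xy => le_trans xy yz)
    (fun x y f => bool_irrelevance _ _) (fun x y f => bool_irrelevance _ _)
    (fun x y z w h g f => bool_irrelevance _ _).

(** * Matchings *)

Definition is_matching (S T : Type) (s : S -> T -> Prop) : Prop :=
  (forall x y y', s x y -> s x y' -> y = y') /\
  (forall x x' y, s x y -> s x' y -> x = x').

Record matching (S T : Type) := Matching {
  mrel :> S -> T -> Prop;
  matchingP : is_matching mrel }.

Lemma matching_ext (S T : Type) (s t : matching S T) :
  (forall x y, s x y <-> t x y) -> s = t.
Proof.
case: s t => [s sm] [t tm] /= st.
have {}st : s = t by apply/funext => x; apply/funext => y; apply/propext.
by rewrite st in sm *; rewrite (Prop_irrelevance sm tm).
Qed.

Definition rel_comp (S T U : Type) (t : T -> U -> Prop) (s : S -> T -> Prop)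
  (x : S) (z : U) : Prop := exists2 y, s x y & t y z.

Lemma eq_is_matching (S : Type) : is_matching (@eq S).
Proof. by split=> x y z -> ->. Qed.

Lemma rel_comp_is_matching (S T U : Type) (t : matching T U)
    (s : matching S T) : is_matching (rel_comp t s).
Proof.
have [[s1 s2] [t1 t2]] := (matchingP s, matchingP t).
split=> [x z z' [y xy yz] [y' xy' yz']|x x' z [y xy yz] [y' xy' yz']].
  by move: yz'; rewrite -(s1 _ _ _ xy xy'); apply: t1.
by move: xy'; rewrite -(t2 _ _ _ yz yz'); apply: s2.
Qed.

Definition Mch : category.
Proof.
refine (@Category Type matching
  (fun S => Matching (@eq_is_matching S))
  (fun S T U t s => Matching (rel_comp_is_matching t s)) _ _ _).
- move=> S T f; apply: matching_ext => x y /=.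
  by split=> [[z ? <-]|?]; last exists y.
- move=> S T f; apply: matching_ext => x y /=.
  by split=> [[z <-]|?]; last exists x.
- move=> S T U V h g f; apply: matching_ext => x w /=.
  split=> [[z [y xy yz] zw]|[y xy [z yz zw]]].
    by exists y => //; exists z.
  by exists z => //; exists y.
Defined.

(** * Barcodes and overlap matchings *)

Section Overlap.
Variable R : realType.

Definition bounds_above (I J : set R) : Prop :=
  forall s, J s -> exists2 t, I t & s <= t.

Definition bounds_below (J I : set R) : Prop :=
  forall t, I t -> exists2 s, J s & s <= t.

Definition overlaps_above (I J : set R) : Prop :=
  [/\ I `&` J !=set0, bounds_above I J & bounds_below J I].

(* The set of intervals S with bars `<=` S * X is not recorded: it is only
   required to exist. *)
Record barcode := Barcode {
  label : Type;
  bars : set (set R * label);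
  barsP : forall b, bars b -> b.1 !=set0 /\ is_interval b.1 }.

Arguments bars : clear implicits.

(* The elements of a barcode, and the interval underlying an element. *)
Definition bar (C : barcode) : Type := bars C.
Definition itv_of (C : barcode) (I : bar C) : set R := (val I).1.

Definition is_overlap_matching (C D : barcode) (s : bar C -> bar D -> Prop) :=
  forall I J, s I J -> overlaps_above (itv_of I) (itv_of J).

Record overlap_matching (C D : barcode) := OverlapMatching {
  omatching :> matching (bar C) (bar D);
  overlapP : is_overlap_matching omatching }.

Lemma overlap_matching_ext (C D : barcode) (s t : overlap_matching C D) :
  (forall I J, s I J <-> t I J) -> s = t.
Proof.
case: s t => [s so] [t to] /= st.
have {}st : s = t by apply: matching_ext.
by rewrite st in so *; rewrite (Prop_irrelevance so to).
Qed.

Definition overlap_comp (C D E : barcode) (t : bar D -> bar E -> Prop)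
    (s : bar C -> bar D -> Prop) (I : bar C) (K : bar E) : Prop :=
  rel_comp t s I K /\ overlaps_above (itv_of I) (itv_of K).

Lemma overlap_comp_is_matching (C D E : barcode) (t : overlap_matching D E)
    (s : overlap_matching C D) : is_matching (overlap_comp t s).
Proof.
have [m1 m2] := rel_comp_is_matching t s.
by split=> [x y y' [? _] [? _]|x x' y [? _] [? _]]; [apply: m1|apply: m2];
  eassumption.
Qed.

Lemma overlap_comp_overlap (C D E : barcode) (t : overlap_matching D E)
    (s : overlap_matching C D) :
  is_overlap_matching (Matching (overlap_comp_is_matching t s)).
Proof. by move=> I J []. Qed.

Lemma eq_overlap (C : barcode) :
  is_overlap_matching (Matching (@eq_is_matching (bar C))).
Proof.
move=> I _ /= <-; have [[t It] _] := barsP (set_mem (valP I)).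
by split; [exists t|move=> s Is; exists s|move=> s Is; exists s].
Qed.

Lemma overlaps_above_mid (I J K L : set R) :
  overlaps_above I J -> overlaps_above J K -> overlaps_above K L ->
  overlaps_above I L ->
  is_interval J -> is_interval K -> overlaps_above I K /\ overlaps_above J L.
Proof.
move=> [_ aIJ bIJ] [_ aJK bJK] [_ aKL bKL] [[p [Ip Lp]] _ _] iJ iK.
have aT A B C : bounds_above A B -> bounds_above B C -> bounds_above A C.
  move=> AB BC s /BC [t /AB[u Au tu] st]; exists u => //; exact: le_trans tu.
have bT A B C : bounds_below B A -> bounds_below C B -> bounds_below C A.
  move=> BA CB s /BA[t /CB[u Cu ut] ts]; exists u => //; exact: le_trans ts.
have aIK := aT _ _ _ aIJ aJK; have bIK := bT _ _ _ bIJ bJK.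
have aJL := aT _ _ _ aJK aKL; have bJL := bT _ _ _ bJK bKL.
split; split=> //; exists p; split=> //.
  have [[q Kq pq] [r Kr rp]] := (aKL _ Lp, bIK _ Ip).
  by apply: (iK _ _ Kr Kq); rewrite rp pq.
have [[q Jq pq] [r Jr rp]] := (aJL _ Lp, bIJ _ Ip).
by apply: (iJ _ _ Jr Jq); rewrite rp pq.
Qed.

Definition Barc : category.
Proof.
refine (@Category barcode overlap_matching
  (fun C => OverlapMatching (@eq_overlap C))
  (fun C D E t s => OverlapMatching (@overlap_comp_overlap C D E t s)) _ _ _).
- move=> C D f; apply: overlap_matching_ext => I J /=.
  split=> [[[K ? <-] _]//|fIJ].
  by split; [exists J|apply: overlapP fIJ].
- move=> C D f; apply: overlap_matching_ext => I J /=.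
  split=> [[[K <- ?] _]//|fIJ].
  by split; [exists I|apply: overlapP fIJ].
- move=> A B C D h g f; apply: overlap_matching_ext => I L /=.
  split=> [[[K [[J IJ JK] IK] KL] IL]|[[J IJ [[K JK KL] JL]] IL]];
    have [_ iJ] := barsP (set_mem (valP J));
    have [_ iK] := barsP (set_mem (valP K));
    have [oIK oJL] := overlaps_above_mid (overlapP IJ) (overlapP JK)
      (overlapP KL) IL iJ iK.
  + split=> //; exists J => //; split=> //; by exists K.
  + split=> //; exists K => //; split=> //; by exists J.
Defined.

Definition MchR : category := functor_cat (poset_cat R) Mch.

(** * From barcodes to diagrams of matchings *)

Definition E_at (D : barcode) (t : R) : set (bar D) :=
  [set I | itv_of I t].

Arguments E_at : clear implicits.

(* That s and t lie in the interval is part of the types of I and J; likewise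
   for E_rel below. *)
Definition E_int_rel (D : barcode) (s t : R) (I : E_at D s) (J : E_at D t) :
  Prop := val I = val J.

Lemma E_int_is_matching (D : barcode) (s t : R) :
  is_matching (@E_int_rel D s t).
Proof.
by split=> [I J J'|I I' J]; rewrite /E_int_rel => IJ IJ'; apply: val_inj;
  rewrite -?IJ -?IJ' ?IJ ?IJ'.
Qed.

Definition E_int (D : barcode) (s t : R) (_ : s <= t) :
  matching (E_at D s) (E_at D t) := Matching (@E_int_is_matching D s t).

Lemma E_is_functor (D : barcode) :
  @is_functor (poset_cat R) Mch (fun t => E_at D t) (@E_int D).
Proof.
split=> [t|s t u tu st]; apply: matching_ext => I J /=; rewrite /E_int_rel.
  by split=> [/val_inj//|->].
split=> [IJ|[K IK KJ]]; last by rewrite /E_int_rel IK KJ.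
have Kt : val I \in E_at D t.
  have [_ iI] := barsP (set_mem (valP (val I))).
  have Is := set_mem (valP I); have := set_mem (valP J); rewrite -IJ => Iu.
  by apply/mem_set; apply: (iI _ _ Is Iu); rewrite st tu.
by exists (exist _ (val I) Kt).
Qed.

Definition E_ob (D : barcode) : MchR := Functor (E_is_functor D).

Definition E_rel (C D : barcode) (s : overlap_matching C D) (t : R)
  (I : E_at C t) (J : E_at D t) : Prop := s (val I) (val J).

(** * From diagrams of matchings to barcodes *)

Section F.
Variable D : functor (poset_cat R) Mch.

Definition points : Type := {t : R & D t}.

Definition germ (p q : points) : Prop :=
  (exists h : projT1 p <= projT1 q,
     (fmor D h : matching _ _) (projT2 p) (projT2 q)) \/
  (exists h : projT1 q <= projT1 p,
     (fmor D h : matching _ _) (projT2 q) (projT2 p)).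

Definition germ_classes : set (set points) :=
  [set Q | exists p, Q = [set q | germ p q]].

Definition supp (Q : set points) : set R := [set projT1 p | p in Q].

Lemma germ_refl p : germ p p.
Proof.
left; exists (lexx _).
rewrite (bool_irrelevance (lexx _) (idc (projT1 p : poset_cat R))).
by rewrite (functor_id (functorP D)).
Qed.

Lemma supp_class Q : germ_classes Q -> supp Q !=set0 /\ is_interval (supp Q).
Proof.
case=> p ->; split.
  by exists (projT1 p), p => //; apply: germ_refl.
move=> _ _ [a pa <-] [b pb <-] z /andP[az zb].
have suppP x : germ p (existT _ z x) -> supp [set q | germ p q] z.
  by move=> px; exists (existT _ z x).
case: p => t x /= in pa pb suppP *.
have [zt|/ltW tz] := leP z t.
  case: pa => /= -[h ax]; last first.
    rewrite (bool_irrelevance h (le_trans az zt)) in ax.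
    have := functor_comp (functorP D)
      (zt : Hom (z : poset_cat R) t) (az : Hom (projT1 a : poset_cat R) z).
    rewrite /compc /= => E; rewrite E in ax.
    case: ax => y ay yx; apply: (suppP y); by right; exists zt.
  have tz : t = z by apply/le_anti; rewrite zt (le_trans h az).
  by subst z; apply: (suppP x); apply: germ_refl.
case: pb => /= -[h bx].
  rewrite (bool_irrelevance h (le_trans tz zb)) in bx.
  have := functor_comp (functorP D)
    (zb : Hom (z : poset_cat R) (projT1 b)) (tz : Hom (t : poset_cat R) z).
  rewrite /compc /= => E; rewrite E in bx.
  case: bx => y xy yb; apply: (suppP y); by left; exists tz.
have zt : t = z by apply/le_anti; rewrite tz (le_trans zb h).
by subst z; apply: (suppP x); apply: germ_refl.
Qed.

Definition F_bars : set (set R * set points) :=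
  [set (supp Q, Q) | Q in germ_classes].

Lemma F_barsP b : F_bars b -> b.1 !=set0 /\ is_interval b.1.
Proof. by case=> Q /supp_class ? <-. Qed.

Definition F_ob : Barc := Barcode F_barsP.

End F.

(* (val I).2 is the label of the bar I of F_ob C, that is, the class Q in
   I = (supp Q, Q). *)
Definition F_rel (C D : functor (poset_cat R) Mch) (eta : nat_trans C D)
    (I : bar (F_ob C)) (J : bar (F_ob D)) : Prop :=
  exists (t : R) (x : C t) (y : D t),
    [/\ (cmpt eta t : matching _ _) x y,
        (val I).2 (existT _ t x) & (val J).2 (existT _ t y)].

End Overlap.

Arguments bars {R} C _ : rename.
Arguments E_at {R} D t _.

(* Main.v *)
(** The unit F E -> 1 matches the class Q with the bar I when Q consists of
    the points (t, I) with t in I; the counit E F -> 1 matches at time t the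
    class Q with x when (t, x) lies in Q.  Both are bijective matchings, and in
    each category a bijective matching (between equal intervals, for barcodes)
    is inverted by its converse relation.

    Everything about F rests on two facts.  Germ equivalence is transitive
    because the internal morphisms are injective partial functions that factor
    through every intermediate time.  If eta relates one pair of points of the
    classes Q and R, it relates every pair of points of Q and R at a common
    time: naturality pulls the later part of R back to Q and pushes the earlier
    part of Q forward to R, which also gives the overlap condition.
    Composition matches the bullet product because, when Q overlaps R and R
    overlaps S above, a time common to Q and S lies in R. *)

From mathcomp Require Import all_boot all_order all_algebra.
From mathcomp Require Import all_classical reals normedtype.
Require Import Defs.

Set Implicit Arguments.
Unset Strict Implicit.
Unset Printing Implicit Defensive.

Import Order.TTheory.
Local Open Scope classical_set_scope.
Local Open Scope ring_scope.

(** * Criteria for isomorphisms in the three categories *)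

Section Isomorphisms.
Variable R : realType.

Lemma converse_is_matching (S T : Type) (s : matching S T) :
  is_matching (fun y x => s x y).
Proof.
by have [s1 s2] := matchingP s; split=> x y y'; [apply: s2|apply: s1].
Qed.

Lemma Mch_is_iso (S T : Type) (s : matching S T) :
  (forall x, exists y, s x y) -> (forall y, exists x, s x y) ->
  @is_iso Mch S T s.
Proof.
have [s1 s2] := matchingP s => sl sr.
exists (Matching (converse_is_matching s)); apply: matching_ext => x y /=.
  split=> [[z xz yz]|<-]; first exact: s2 xz yz.
  by have [z xz] := sl x; exists z.
split=> [[z zx zy]|<-]; first exact: s1 zx zy.
by have [z zx] := sr x; exists z.
Qed.

(** Pointwise inverses are automatically natural: they conjugate the naturality square of [a]. As
    [is_iso] only asserts existence, choice first selects an inverse at each object. *)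
Lemma functor_cat_is_iso (C D : category) (F G : functor C D)
    (a : nat_trans F G) :
  (forall x, is_iso (a x)) -> @is_iso (functor_cat C D) F G a.
Proof.
move=> a_iso.
have [b bP] : exists b : forall x, Hom (G x) (F x), forall x,
    compc (b x) (a x) = idc (F x) /\ compc (a x) (b x) = idc (G x).
  have inv x : {b : Hom (G x) (F x) |
      compc b (a x) = idc (F x) /\ compc (a x) b = idc (G x)}.
    by apply: cid; have [b ba ab] := a_iso x; exists b.
  by exists (fun x => sval (inv x)) => x; exact: svalP (inv x).
have b_nat (x y : C) (f : Hom x y) :
    compc (b y) (fmor G f) = compc (fmor F f) (b x).
  have [[_ abx] [bay _]] := (bP x, bP y).
  rewrite -[fmor G f]compc_idr -abx [compc (fmor G f) _]compcA.
  by rewrite -naturality !compcA bay compc_idl.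
by exists (NatTrans b_nat); apply: nat_trans_ext => x /=; have [] := bP x.
Qed.

(** Equality of the intervals makes the converse an overlap matching. The bullet products lose no
    pair, since every bar overlaps itself above. *)
Lemma Barc_is_iso (C D : barcode R) (s : overlap_matching C D) :
  (forall I J, s I J -> itv_of I = itv_of J) ->
  (forall I, exists J, s I J) -> (forall J, exists I, s I J) ->
  @is_iso (Barc R) C D s.
Proof.
move=> s_itv sl sr; have [s1 s2] := matchingP s.
have conv_overlap : is_overlap_matching (Matching (converse_is_matching s)).
  move=> J I IJ; have := s_itv _ _ IJ; have := overlapP IJ.
  by move=> /[swap] ->.
exists (OverlapMatching conv_overlap); apply: overlap_matching_ext => I K /=.
  split=> [[[J IJ KJ] _]|<-]; first exact: s2 IJ KJ.
  have [J IJ] := sl I; split; first by exists J.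
  exact: (@eq_overlap _ C I I).
split=> [[[J JI JK] _]|<-]; first exact: s1 JI JK.
have [J JI] := sr I; split; first by exists J.
exact: (@eq_overlap _ D I I).
Qed.

End Isomorphisms.

(** * Pointwise consequences of the overlap condition *)

Section Overlaps.
Variable R : realType.
Implicit Types I J K : set R.

Lemma overlaps_above_up I J (s t : R) : is_interval I -> overlaps_above I J ->
  I s -> s <= t -> J t -> I t.
Proof.
move=> iI [_ IJ _] Is st /IJ[u Iu tu].
by apply: (iI _ _ Is Iu); rewrite st tu.
Qed.

Lemma overlaps_above_down I J (s t : R) : is_interval J -> overlaps_above I J ->
  J t -> s <= t -> I s -> J s.
Proof.
move=> iJ [_ _ JI] Jt st /JI[u Ju us].
by apply: (iJ _ _ Ju Jt); rewrite us st.
Qed.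

(** [J] has a point below [t] because it bounds [I] below, and one above [t] because it bounds [K]
    above. *)
Lemma overlaps_above_mem_mid I J K (t : R) : is_interval J ->
  overlaps_above I J -> overlaps_above J K -> I t -> K t -> J t.
Proof.
move=> iJ [_ _ JI] [_ JK _] /JI[s Js st] /JK[u Ju tu].
by apply: (iJ _ _ Js Ju); rewrite st tu.
Qed.

(** The two bounding conditions compose; non-emptiness of the intersection does not, and the common
    time [t] supplies it. *)
Lemma overlaps_above_trans I J K (t : R) :
  overlaps_above I J -> overlaps_above J K -> I t -> K t -> overlaps_above I K.
Proof.
move=> [_ aIJ bIJ] [_ aJK bJK] It Kt; split; first by exists t.
  by move=> s /aJK[u /aIJ[v Iv uv] su]; exists v => //; apply: le_trans uv.
by move=> s /bIJ[u /bJK[v Kv vu] us]; exists v => //; apply: le_trans us.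
Qed.

Lemma bar_interval (C : barcode R) (I : bar C) : is_interval (itv_of I).
Proof. by have [] := barsP (set_mem (valP I)). Qed.

End Overlaps.

(** * The functor E on overlap matchings *)

Section EMorphisms.
Variable R : realType.

Lemma E_rel_is_matching (C D : barcode R) (s : overlap_matching C D) (t : R) :
  is_matching (@E_rel R C D s t).
Proof.
have [s1 s2] := matchingP s.
by split=> [I J J' h h'|I I' J h h']; apply: val_inj;
  [apply: s1 h h'|apply: s2 h h'].
Qed.

Definition E_cmpt (C D : barcode R) (s : overlap_matching C D) (t : R) :
  matching (E_at C t) (E_at D t) := Matching (@E_rel_is_matching C D s t).

(** Let [s] match [I], alive at [t], with [J], alive at [u]. One side of the square needs [I] at
    [u], the other [J] at [t]; as [I] overlaps [J] above, each follows. *)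
Lemma E_cmpt_natural (C D : barcode R) (s : overlap_matching C D)
    (t u : poset_cat R) (h : Hom t u) :
  @compc Mch _ _ _ (E_cmpt s u) (fmor (E_ob C) h) =
  @compc Mch _ _ _ (fmor (E_ob D) h) (E_cmpt s t).
Proof.
apply: matching_ext => I J /=; rewrite /E_int_rel /E_rel.
have It : itv_of (val I) t := set_mem (valP I).
have Ju : itv_of (val J) u := set_mem (valP J).
split=> [[K IK /= KJ]|[K /= IK KJ]].
  rewrite /E_rel -IK in KJ.
  have Jt : val J \in E_at D t.
    apply/mem_set; rewrite /E_at /=.
    exact: overlaps_above_down (@bar_interval _ _ _) (overlapP KJ) Ju h It.
  by exists (exist _ (val J) Jt).
rewrite /E_rel KJ in IK.
have Iu : val I \in E_at C u.
  apply/mem_set; rewrite /E_at /=.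
  exact: overlaps_above_up (@bar_interval _ _ _) (overlapP IK) It h Ju.
by exists (exist _ (val I) Iu).
Qed.

Definition E_mor (C D : Barc R) (s : Hom C D) : Hom (E_ob C) (E_ob D) :=
  @NatTrans (poset_cat R) Mch (E_ob C) (E_ob D) (E_cmpt s)
    (E_cmpt_natural s).

Lemma E_mor_is_functor : is_functor E_mor.
Proof.
split=> [C|A B C g f]; apply: nat_trans_ext => t; apply: matching_ext => I K /=;
  rewrite /E_rel.
  by split=> [/val_inj|->].
(* A time in both outer bars lies in the middle bar, and it makes the overlap condition of the
   bullet product automatic. *)
have It : itv_of (val I) t := set_mem (valP I).
have Kt : itv_of (val K) t := set_mem (valP K).
split=> [[[J IJ JK] _]|[J IJ JK]].
  have Jt : J \in E_at B t.
    apply/mem_set; rewrite /E_at /=.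
    exact: overlaps_above_mem_mid (@bar_interval _ _ _)
      (overlapP IJ) (overlapP JK) It Kt.
  by exists (exist _ J Jt).
split; first by exists (val J).
exact: overlaps_above_trans (overlapP IJ) (overlapP JK) It Kt.
Qed.

End EMorphisms.

(** * Germ equivalence *)

Section Germs.
Variable R : realType.
Implicit Types C D : functor (poset_cat R) Mch.

(** One directed half of [germ]: [germ p q] unfolds to [transition p q] or [transition q p]. *)
Definition transition D (p q : points D) : Prop :=
  exists h : projT1 p <= projT1 q,
    (fmor D h : matching _ _) (projT2 p) (projT2 q).

(** Here and in [fmor_comp] the proofs of the inequalities are arbitrary; proof irrelevance
    identifies them with the identity and composite arrows. *)
Lemma fmor_id D (t : R) (h : t <= t) (x y : D t) :
  (@fmor _ _ D t t h : matching _ _) x y <-> x = y.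
Proof.
rewrite (bool_irrelevance h (idc (t : poset_cat R))).
by rewrite (functor_id (functorP D)).
Qed.

Lemma fmor_comp D (s t u : R) (st : s <= t) (tu : t <= u) (su : s <= u)
    (x : D s) (z : D u) :
  (@fmor _ _ D s u su : matching _ _) x z <->
  exists2 y, (@fmor _ _ D s t st : matching _ _) x y &
             (@fmor _ _ D t u tu : matching _ _) y z.
Proof.
rewrite (bool_irrelevance su (@compc (poset_cat R) s t u tu st)).
by rewrite (functor_comp (functorP D)).
Qed.

Lemma transition_trans D (p q r : points D) :
  transition p q -> transition q r -> transition p r.
Proof.
move=> [pq xy] [qr yz]; exists (le_trans pq qr).
by apply/(fmor_comp pq qr); exists (projT2 q).
Qed.

Lemma transition_split D (p r : points D) (t : R) :
  transition p r -> projT1 p <= t -> t <= projT1 r ->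
  exists y : D t, transition p (existT _ t y) /\ transition (existT _ t y) r.
Proof.
move=> [pr xz] pt tr; have /(fmor_comp pt tr)[y xy yz] := xz.
by exists y; split; [exists pt|exists tr].
Qed.

Lemma transition_funl D (t : R) (x y : D t) (p : points D) :
  transition p (existT _ t x) -> transition p (existT _ t y) -> x = y.
Proof.
move=> [/= h px] [/= h']; rewrite (bool_irrelevance h' h) => py.
by have [m _] := matchingP (fmor D h : matching _ _); apply: m px py.
Qed.

Lemma transition_funr D (t : R) (x y : D t) (p : points D) :
  transition (existT _ t x) p -> transition (existT _ t y) p -> x = y.
Proof.
move=> [/= h px] [/= h']; rewrite (bool_irrelevance h' h) => py.
by have [_ m] := matchingP (fmor D h : matching _ _); apply: m px py.
Qed.

Lemma germ_sym D (p q : points D) : germ p q -> germ q p.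
Proof. by case; [right|left]. Qed.

Lemma germ_trans D (p q r : points D) : germ p q -> germ q r -> germ p r.
Proof.
(* Two points with a common image: the transition from the earlier one passes through the time of
   the later one, where injectivity identifies the intermediate point with the later one. *)
have up (a b c : points D) : projT1 a <= projT1 c ->
    transition a b -> transition c b -> transition a c.
  case: c => t z /= ac ab cb; have [bt _] := cb.
  have [y [ay yb]] := transition_split ab ac bt.
  by rewrite (transition_funr cb yb).
(* Dually, for two images of one point, the transition to the later image passes through the earlier
   one by functionality. *)
have down (a b c : points D) : projT1 a <= projT1 c ->
    transition b a -> transition b c -> transition a c.
  case: a => t x /= ac ba bc; have [bt _] := ba.
  have [y [By yc]] := transition_split bc bt ac.
  by rewrite (transition_funl ba By).
case=> [pq|qp] [qr|rq].
- by left; apply: transition_trans pq qr.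
- have [pr|/ltW rp] := leP (projT1 p) (projT1 r).
    by left; apply: up pq rq.
  by right; apply: up rq pq.
- have [pr|/ltW rp] := leP (projT1 p) (projT1 r).
    by left; apply: down qp qr.
  by right; apply: down qr qp.
- by right; apply: transition_trans rq qp.
Qed.

(** If the germ comes from a transition from [q] to [p], the two times coincide and that transition
    is an identity, so it can be reversed. *)
Lemma germ_le D (p q : points D) :
  germ p q -> projT1 p <= projT1 q -> transition p q.
Proof.
case=> // -[]; case: p q => [s x] [t y] /= ts yx st.
have ets : t = s by apply: le_anti; rewrite ts st.
subst t; move/fmor_id: yx => ->.
by exists st; apply/fmor_id.
Qed.

Lemma germ_inj D (t : R) (x y : D t) :
  germ (existT _ t x) (existT _ t y) -> x = y.
Proof. by move=> /germ_le /(_ (lexx t)) [/= h] /fmor_id. Qed.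

(** * Germ classes as bars *)

Section Classes.
Variable D : functor (poset_cat R) Mch.

Lemma germ_class_germ (Q : set (points D)) (p q : points D) :
  germ_classes Q -> Q p -> Q q -> germ p q.
Proof. by move=> [r ->] rp rq; apply: germ_trans rq; apply: germ_sym. Qed.

Lemma germ_class_closed (Q : set (points D)) (p q : points D) :
  germ_classes Q -> Q p -> germ p q -> Q q.
Proof. by move=> [r ->] rp pq; apply: germ_trans pq. Qed.

Lemma germ_class_eq (Q Q' : set (points D)) (p : points D) :
  germ_classes Q -> germ_classes Q' -> Q p -> Q' p -> Q = Q'.
Proof.
move=> cQ cQ' Qp Q'p; apply/seteqP; split=> q Hq.
  exact: germ_class_closed cQ' Q'p (germ_class_germ cQ Qp Hq).
exact: germ_class_closed cQ Qp (germ_class_germ cQ' Q'p Hq).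
Qed.

Definition class_of (I : bar (F_ob D)) : set (points D) := (val I).2.

Lemma class_ofP (I : bar (F_ob D)) : germ_classes (class_of I).
Proof. by have [Q cQ IQ] := set_mem (valP I); rewrite /class_of -IQ. Qed.

Lemma itv_ofE (I : bar (F_ob D)) : itv_of I = supp (class_of I).
Proof.
by have [Q cQ IQ] := set_mem (valP I); rewrite /class_of /itv_of -IQ.
Qed.

Lemma itv_ofP (I : bar (F_ob D)) (t : R) :
  itv_of I t <-> exists x : D t, class_of I (existT _ t x).
Proof.
rewrite itv_ofE; split=> [[[s x] Ix /= <-]|[x Ix]]; first by exists x.
by exists (existT _ t x).
Qed.

(** A bar is the pair of [supp Q] and [Q], hence determined by its class, and classes sharing a
    point are equal. *)
Lemma bar_class_eq (I J : bar (F_ob D)) (p : points D) :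
  class_of I p -> class_of J p -> I = J.
Proof.
move=> Ip Jp; apply: val_inj.
have e := germ_class_eq (class_ofP I) (class_ofP J) Ip Jp.
rewrite [LHS]surjective_pairing [RHS]surjective_pairing.
by congr pair; [rewrite -/(itv_of I) -/(itv_of J) !itv_ofE e|apply: e].
Qed.

Lemma bar_germ (I : bar (F_ob D)) (p q : points D) :
  class_of I p -> class_of I q -> germ p q.
Proof. exact: germ_class_germ (class_ofP I). Qed.

Lemma bar_closed (I : bar (F_ob D)) (p q : points D) :
  class_of I p -> germ p q -> class_of I q.
Proof. exact: germ_class_closed (class_ofP I). Qed.

Lemma bar_inj (I : bar (F_ob D)) (t : R) (x y : D t) :
  class_of I (existT _ t x) -> class_of I (existT _ t y) -> x = y.
Proof. by move=> Ix Iy; apply: germ_inj (bar_germ Ix Iy). Qed.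

Lemma bar_through (p : points D) : exists I : bar (F_ob D), class_of I p.
Proof.
have mQ : (supp [set q | germ p q], [set q | germ p q]) \in bars (F_ob D).
  by apply/mem_set; exists [set q | germ p q] => //; exists p.
by exists (exist (fun b => b \in bars (F_ob D)) _ mQ); apply: germ_refl.
Qed.

End Classes.

(** * The functor F on natural transformations *)

Section FRel.
Variables (C D : functor (poset_cat R) Mch) (eta : nat_trans C D).

(** The naturality square read from the side through [D t] to the side through [C u];
    [nat_trans_down] reads it the other way. *)
Lemma nat_trans_up (t u : R) (x : C t) (y : D t) (y' : D u) :
  (cmpt eta t : matching _ _) x y ->
  transition (existT _ t y) (existT _ u y') ->
  exists2 x' : C u, transition (existT _ t x) (existT _ u x') &
    (cmpt eta u : matching _ _) x' y'.
Proof.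
move=> xy [/= tu yy'].
have /(congr1 (fun m : matching _ _ => m x y')) /= e :=
  naturality eta (tu : @Hom (poset_cat R) t u).
have : rel_comp (fmor D tu : matching _ _) (cmpt eta t : matching _ _) x y'.
  by exists y.
by rewrite -e => -[x' xx' x'y']; exists x' => //; exists tu.
Qed.

Lemma nat_trans_down (t u : R) (x : C t) (x' : C u) (y' : D u) :
  transition (existT _ t x) (existT _ u x') ->
  (cmpt eta u : matching _ _) x' y' ->
  exists2 y : D t, (cmpt eta t : matching _ _) x y &
    transition (existT _ t y) (existT _ u y').
Proof.
move=> [/= tu xx'] xy'.
have /(congr1 (fun m : matching _ _ => m x y')) /= e :=
  naturality eta (tu : @Hom (poset_cat R) t u).
have : rel_comp (cmpt eta u : matching _ _) (fmor C tu : matching _ _) x y'.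
  by exists x'.
by rewrite e => -[y xy yy']; exists y => //; exists tu.
Qed.

(** Moving forward in time, naturality finds a partner of [y'] reached from [x], which is [x'] by
    functionality of the transitions. Moving backward, it finds a partner of [x'] that leads to [y],
    which is [y'] by their injectivity. *)
Lemma nat_trans_germ (t u : R) (x : C t) (y : D t) (x' : C u) (y' : D u) :
  (cmpt eta t : matching _ _) x y ->
  germ (existT _ t x) (existT _ u x') -> germ (existT _ t y) (existT _ u y') ->
  (cmpt eta u : matching _ _) x' y'.
Proof.
move=> xy xx' yy'; have [tu|/ltW ut] := leP t u.
  have [z xz zy'] := nat_trans_up xy (germ_le yy' tu).
  by rewrite (transition_funl (germ_le xx' tu) xz).
have [z xz zy] := nat_trans_down (germ_le (germ_sym xx') ut) xy.
by rewrite (transition_funr (germ_le (germ_sym yy') ut) zy).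
Qed.

Lemma F_rel_cmpt (I : bar (F_ob C)) (J : bar (F_ob D)) (t : R)
    (x : C t) (y : D t) :
  F_rel eta I J -> class_of I (existT _ t x) -> class_of J (existT _ t y) ->
  (cmpt eta t : matching _ _) x y.
Proof.
move=> [u [x' [y' [xy Ix' Jy']]]] Ix Jy.
by apply: nat_trans_germ xy _ _; apply: bar_germ; eassumption.
Qed.

Lemma F_rel_is_matching : is_matching (@F_rel R C D eta).
Proof.
split=> [I J J'|I I' J] [t [x [y [xy Ix Jy]]]] [u [x' [y' [xy' Ix' Jy']]]].
  (* Functionality: the later of the two pairs is restricted to the earlier time, where [eta] is
     functional. *)
  apply: (@bar_class_eq _ _ _ (existT _ u y')) => //.
  have [tu|/ltW ut] := leP t u.
    have [z xz zy'] := nat_trans_down (germ_le (bar_germ Ix Ix') tu) xy'.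
    have [m _] := matchingP (cmpt eta t : matching _ _).
    by apply: bar_closed Jy _; left; rewrite (m _ _ _ xy xz).
  have [z xz zy] := nat_trans_down (germ_le (bar_germ Ix' Ix) ut) xy.
  have [m _] := matchingP (cmpt eta u : matching _ _).
  by apply: bar_closed Jy _; right; rewrite (m _ _ _ xy' xz).
(* Injectivity: the earlier pair is pushed to the later time, where [eta] is injective. *)
apply: (@bar_class_eq _ _ _ (existT _ u x')) => //.
have [tu|/ltW ut] := leP t u.
  have [z xz zy'] := nat_trans_up xy (germ_le (bar_germ Jy Jy') tu).
  have [_ m] := matchingP (cmpt eta u : matching _ _).
  by apply: bar_closed Ix _; left; rewrite (m _ _ _ xy' zy').
have [z xz zy] := nat_trans_up xy' (germ_le (bar_germ Jy' Jy) ut).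
have [_ m] := matchingP (cmpt eta t : matching _ _).
by apply: bar_closed Ix _; right; rewrite (m _ _ _ xy zy).
Qed.

(** Fix a time [t] at which [eta] relates [I] to [J]. Times of [J] after [t] lie in [I] and times of
    [I] before [t] lie in [J], by naturality; for all other times [t] itself is the required
    bound. *)
Lemma F_rel_overlap :
  is_overlap_matching (Matching F_rel_is_matching).
Proof.
move=> I J [t [x [y [xy Ix Jy]]]].
have It : itv_of I t by apply/itv_ofP; exists x.
have Jt : itv_of J t by apply/itv_ofP; exists y.
split; first by exists t.
  move=> u /itv_ofP[y' Jy']; have [tu|/ltW ut] := leP t u; last by exists t.
  have [x' xx' _] := nat_trans_up xy (germ_le (bar_germ Jy Jy') tu).
  exists u => //; apply/itv_ofP; exists x'.
  by apply: bar_closed Ix _; left.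
move=> u /itv_ofP[x' Ix']; have [tu|/ltW ut] := leP t u; first by exists t.
have [y' _ yy'] := nat_trans_down (germ_le (bar_germ Ix' Ix) ut) xy.
exists u => //; apply/itv_ofP; exists y'.
by apply: bar_closed Jy _; right.
Qed.

End FRel.

Definition F_mor (C D : MchR R) (eta : Hom C D) : Hom (F_ob C) (F_ob D) :=
  OverlapMatching (@F_rel_overlap C D eta).

Lemma F_mor_is_functor : is_functor F_mor.
Proof.
split=> [D|A B C b a]; apply: overlap_matching_ext => I K.
  split=> [[t [x [y [/= <- Ix Kx]]]]|<-]; first exact: bar_class_eq Ix Kx.
  have [[t /itv_ofP[x Ix]] _] := barsP (set_mem (valP I)).
  by exists t, x, x; split.
split=> [IK|[[J IJ JK] oIK]].
  split; last exact: (@F_rel_overlap _ _ (compc b a)) IK.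
  case: IK => t [x [z [[y xy yz] Ix Kz]]].
  have [J Jy] := bar_through (existT _ t y : points B).
  by exists J; [exists t, x, y|exists t, y, z].
(* The relations [IJ] and [JK] may be witnessed at different times; both are moved to a time common
   to [I] and [K]. *)
have [[t [It Kt]] _ _] := oIK.
have Jt := overlaps_above_mem_mid (@bar_interval _ _ J)
  (overlapP IJ) (overlapP JK) It Kt.
move: It Jt Kt => /itv_ofP[x Ix] /itv_ofP[y Jy] /itv_ofP[z Kz].
exists t, x, z; split=> //.
by exists y; [apply: F_rel_cmpt IJ Ix Jy|apply: F_rel_cmpt JK Jy Kz].
Qed.

End Germs.

(** * The functors, and the isomorphism from F E to the identity *)

Section Equivalence.
Variable R : realType.

Definition E : functor (Barc R) (MchR R) := Functor (@E_mor_is_functor R).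
Definition F : functor (MchR R) (Barc R) := Functor (@F_mor_is_functor R).

Section BarcUnit.
Variable C : barcode R.

Definition FE_rel (Q : bar (F_ob (E_ob C))) (I : bar C) : Prop :=
  exists (t : R) (It : I \in E_at C t),
    class_of Q (existT (E_ob C) t (exist _ I It)).

(** The internal morphisms of [E_ob C] are equality of bars, and the types of the points already
    place both times in the bar. *)
Lemma germ_E (p q : points (E_ob C)) :
  germ p q <-> val (projT2 p) = val (projT2 q).
Proof.
split=> [[[h]|[h]]//|e].
by have [h|/ltW h] := leP (projT1 p) (projT1 q); [left|right]; exists h.
Qed.

(** By [germ_E], the points of [Q] are the copies of [I] at all the times in [I]. *)
Lemma FE_rel_itv Q I : FE_rel Q I -> itv_of Q = itv_of I.
Proof.
case=> t [It QI]; apply/seteqP; split=> u.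
  move=> /itv_ofP[J QJ]; have /germ_E /= -> := bar_germ QI QJ.
  exact: set_mem (valP J).
move=> /mem_set Iu; apply/itv_ofP; exists (exist _ I Iu).
by apply: bar_closed QI _; apply/germ_E.
Qed.

Lemma FE_rel_is_matching : is_matching FE_rel.
Proof.
split=> [Q I J [t [It QI]] [u [Ju QJ]]|Q Q' I [t [It QI]] [u [Iu Q'I]]].
  by have /germ_E := bar_germ QI QJ.
apply: (bar_class_eq QI); apply: bar_closed Q'I _.
by apply/germ_E.
Qed.

Lemma FE_rel_overlap : is_overlap_matching (Matching FE_rel_is_matching).
Proof.
move=> Q I /FE_rel_itv e; rewrite e.
exact: (@eq_overlap _ C I I).
Qed.

Definition FE_cmpt : overlap_matching (F_ob (E_ob C)) C :=
  OverlapMatching FE_rel_overlap.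

Lemma FE_rel_total Q : exists I, FE_rel Q I.
Proof.
have [[t /itv_ofP[[I It] QI]] _] := barsP (set_mem (valP Q)).
by exists I, t, It.
Qed.

Lemma FE_rel_surj I : exists Q, FE_rel Q I.
Proof.
have [[t It'] _] := barsP (set_mem (valP I)).
have It : I \in E_at C t by apply/mem_set.
have [Q QI] :=
  bar_through (existT (E_ob C) t (exist _ I It) : points (E_ob C)).
by exists Q, t, It.
Qed.

End BarcUnit.

(** Both sides carry the same overlap condition on [Q] and [J], so only the relational composites
    are compared. *)
Lemma FE_natural (C D : Barc R) (s : Hom C D) :
  compc (FE_cmpt D : Hom (functor_o F E D) (functor_1 (Barc R) D))
    (fmor (functor_o F E) s) =
  compc (fmor (functor_1 (Barc R)) s) (FE_cmpt C).
Proof.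
apply: overlap_matching_ext => Q J;
  split=> [[[Q' QQ' Q'J] oQJ]|[[I QI IJ] oQJ]];
  split=> //.
  case: QQ' => t [[I It] [[J' Jt] [sIJ QI Q'J']]].
  exists I; first by exists t, It.
  have Q'J'' : FE_rel Q' J' by exists t, Jt.
  by have [m _] := FE_rel_is_matching D; rewrite (m _ _ _ Q'J Q'J'').
(* The middle bar is the class of [J], and a time common to [I] and [J] witnesses that it is related
   to [Q]. *)
have [[t [It' Jt']] _ _] := overlapP IJ.
have It : I \in E_at C t by apply/mem_set.
have Jt : J \in E_at D t by apply/mem_set.
have [Q' Q'J] :=
  bar_through (existT (E_ob D) t (exist _ J Jt) : points (E_ob D)).
exists Q'; last by exists t, Jt.
exists t, (exist _ I It), (exist _ J Jt); split=> //.
case: QI => u [Iu QI]; apply: bar_closed QI _.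
exact/germ_E.
Qed.

Lemma FE_isomorphic_1 : nat_isomorphic (functor_o F E) (functor_1 (Barc R)).
Proof.
exists (NatTrans FE_natural) => C.
apply: Barc_is_iso; [exact: FE_rel_itv|exact: FE_rel_total|exact: FE_rel_surj].
Qed.

(** * The isomorphism from E F to the identity *)

Section MchRUnit.
Variable D : functor (poset_cat R) Mch.

Definition EF_rel (t : R) (I : E_at (F_ob D) t) (x : D t) : Prop :=
  class_of (val I) (existT _ t x).

Lemma EF_rel_is_matching t : is_matching (@EF_rel t).
Proof.
split=> [I x y Ix Iy|I J x Ix Jx]; first exact: bar_inj Ix Iy.
by apply: val_inj; apply: bar_class_eq Ix Jx.
Qed.

Definition EF_matching t : matching (E_at (F_ob D) t) (D t) :=
  Matching (@EF_rel_is_matching t).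

Lemma EF_matching_natural (t u : poset_cat R) (h : Hom t u) :
  @compc Mch _ _ _ (EF_matching u) (fmor (E_ob (F_ob D)) h) =
  @compc Mch _ _ _ (fmor D h) (EF_matching t).
Proof.
apply: matching_ext => I y; split=> [[J /= IJ Jy]|[x Ix xy]].
  (* The class of [I] has a point [x] at time [t]; it is equivalent to [y] and not later, so it is
     carried to [y]. *)
  have /itv_ofP[x Ix] := set_mem (valP I).
  exists x => //; rewrite /= /EF_rel -IJ in Jy.
  have [h' xy] := germ_le (bar_germ Ix Jy) h.
  by rewrite (bool_irrelevance h h').
have Iy : class_of (val I) (existT _ u y).
  by apply: bar_closed Ix _; left; exists h.
have Iu : val I \in E_at (F_ob D) u by apply/mem_set/itv_ofP; exists y.
by exists (exist _ (val I) Iu).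
Qed.

Definition EF_cmpt : nat_trans (E_ob (F_ob D)) D := 
  @NatTrans (poset_cat R) Mch (E_ob (F_ob D)) D EF_matching EF_matching_natural.

Lemma EF_cmpt_is_iso : @is_iso (MchR R) _ _ EF_cmpt.
Proof.
apply: functor_cat_is_iso => t; apply: Mch_is_iso => [I|x].
  by have /itv_ofP := set_mem (valP I).
have [I Ix] := bar_through (existT _ t x : points D).
have It : I \in E_at (F_ob D) t by apply/mem_set/itv_ofP; exists x.
by exists (exist _ I It).
Qed.

End MchRUnit.

(** In one direction [F_rel_cmpt] evaluates the relation between classes at time [t]; in the other
    the class through [y] is the middle bar. *)
Lemma EF_natural (C D : MchR R) (a : Hom C D) :
  compc (EF_cmpt D : Hom (functor_o E F D) (functor_1 (MchR R) D))
    (fmor (functor_o E F) a) =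
  compc (fmor (functor_1 (MchR R)) a) (EF_cmpt C).
Proof.
apply: nat_trans_ext => t; apply: matching_ext => I y.
split=> [[J IJ Jy]|[x Ix xy]].
  have /itv_ofP[x Ix] := set_mem (valP I).
  by exists x => //; apply: F_rel_cmpt IJ Ix Jy.
have [J Jy] := bar_through (existT _ t y : points D).
have Jt : J \in E_at (F_ob D) t by apply/mem_set/itv_ofP; exists y.
by exists (exist _ J Jt) => //; exists t, x, y.
Qed.

Lemma EF_isomorphic_1 : nat_isomorphic (functor_o E F) (functor_1 (MchR R)).
Proof. exists (NatTrans EF_natural) => D; exact: EF_cmpt_is_iso. Qed.

End Equivalence.

(** Prescribing the underlying relations determines the two actions on morphisms, by extensionality
    of matchings, overlap matchings and natural transformations. *)
Theorem mainTheorem1 (R : realType) :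
  exists (E_mor : forall C D : Barc R, Hom C D -> Hom (E_ob C) (E_ob D))
         (F_mor : forall C D : MchR R, Hom C D -> Hom (F_ob C) (F_ob D)),
    (forall (C D : barcode R) (s : overlap_matching C D) (t : R),
       mrel (cmpt (E_mor C D s) t) = E_rel s (t := t)) /\
    (forall (C D : functor (poset_cat R) Mch) (eta : nat_trans C D),
       mrel (omatching (F_mor C D eta)) = F_rel eta) /\
    exists (E_functor : is_functor E_mor) (F_functor : is_functor F_mor),
      let E : functor (Barc R) (MchR R) := Functor E_functor in
      let F : functor (MchR R) (Barc R) := Functor F_functor in
      nat_isomorphic (functor_o F E) (functor_1 (Barc R)) /\
      nat_isomorphic (functor_o E F) (functor_1 (MchR R)) /\
      is_equivalence E.
Proof.
exists (@E_mor R), (@F_mor R); split=> //; split=> //.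
exists (@E_mor_is_functor R), (@F_mor_is_functor R) => E F.
split; first exact: FE_isomorphic_1.
split; first exact: EF_isomorphic_1.
by exists F; split; [exact: FE_isomorphic_1|exact: EF_isomorphic_1].
Qed.
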